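(* For every set $F\subset \mathbb{R}^d$ satisfying $\inf\{\|x-y\| : x,y\in F,\ x\neq y\}>0$, we have $$\overline{\dim}_{\zeta} F = e(F).$$ In particular, for all $F\subseteq \mathbb{Z}^d$, we have $$\overline{\dim}_{\zeta} F=\mathrm{Dim}_{\zeta} F.$$
   Context: $\|\cdot\|$ is the Euclidean norm on $\mathbb{R}^d$, and $\mathbb{R}^d$ carries the Euclidean metric. Convention: $\inf\emptyset=\infty$ for subsets of $[0,\infty)$. Upper zeta dimension: let $(X,d)$ be a metric space and fix $\alpha\in X$. $B(\alpha,R)$ denotes the closed ball centered at $\alpha$ with radius $R>0$. For $E\subseteq X$ and $r>0$, $N(E,r)$ denotes the smallest number of sets of diameter at most $r$ required to cover $E$ ($N(E,r)=\infty$ if no finite such cover exists). For $F\subseteq X$, $$\overline{\dim}_{\zeta}F=\lim_{r\to\infty}\inf\Big\{\sigma\ge 0 : \exists C>0\ \exists R_0>0\ \forall R\ge R_0\ \ N\big(B(\alpha,R)\cap F,r\big)\le C R^{\sigma}\Big\}.$$ The limit exists in $[0,\infty]$ and does not depend on $\alpha\in X$. Here $X=\mathbb{R}^d$. Exponent: for a discrete set $F\subset\mathbb{R}^d$, $e(F)=\inf\{\sigma\ge 0 : \sum_{v\in F\setminus\{0\}}\|v\|^{-\sigma}<\infty\}$. Classical zeta dimension: for $A\subseteq\mathbb{Z}^d$, $\mathrm{Dim}_{\zeta}A=\inf\{\sigma\ge 0:\zeta_A(\sigma)<\infty\}$, where $\zeta_A(\sigma)=\sum_{v\in A\setminus\{0\}}\|v\|^{-\sigma}$.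 *)

(* Defs.v *)
From HB Require Import structures.
From mathcomp Require Import all_boot all_order all_algebra.
From mathcomp Require Import all_classical all_reals all_analysis.
From mathcomp Require Import ring lra.

Set Implicit Arguments.
Unset Strict Implicit.
Unset Printing Implicit Defensive.

Import Order.TTheory GRing.Theory Num.Theory.

Local Open Scope classical_set_scope.
Local Open Scope ring_scope.

(** The library puts the sup norm on ['rV[R]_d]; [euclidean R d] is the same
    space with the Euclidean norm and metric. *)
Definition euclidean (R : realType) (d : nat) : Type := 'rV[R]_d.

Section euclidean_space.
Context {R : realType} {d : nat}.

HB.instance Definition _ := GRing.Lmodule.on (euclidean R d).

Implicit Types u v w : euclidean R d.

Definition ecoord v (i : 'I_d) : R := (v : 'rV[R]_d) ord0 i.

Definition dotprod u v : R := \sum_i ecoord u i * ecoord v i.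

Definition enorm v : R := Num.sqrt (\sum_i ecoord v i ^+ 2).

Lemma ecoordD u v i : ecoord (u + v) i = ecoord u i + ecoord v i.
Proof. exact: mxE. Qed.

Lemma ecoordN u i : ecoord (- u) i = - ecoord u i.
Proof. exact: mxE. Qed.

Lemma ecoord_eqP u v : (forall i, ecoord u i = ecoord v i) -> u = v.
Proof. by move=> uv; apply/rowP => i; exact: uv. Qed.

Lemma sumsq_ge0 v : 0 <= \sum_i ecoord v i ^+ 2.
Proof. by apply: sumr_ge0 => i _; exact: sqr_ge0. Qed.

Lemma enorm_ge0 v : 0 <= enorm v.
Proof. exact: sqrtr_ge0. Qed.

Lemma sqr_enorm v : enorm v ^+ 2 = \sum_i ecoord v i ^+ 2.
Proof. by rewrite sqr_sqrtr// sumsq_ge0. Qed.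

Lemma dotprod_le u v : dotprod u v <= enorm u * enorm v.
Proof.
suff H : dotprod u v ^+ 2 <= (enorm u * enorm v) ^+ 2.
  apply: (le_trans (ler_norm _)).
  rewrite -(@ler_pXn2r _ 2)// ?nnegrE ?mulr_ge0 ?enorm_ge0//.
  by rewrite real_normK ?num_real.
rewrite exprMn !sqr_enorm.
set a := \sum_i ecoord u i ^+ 2; set b := \sum_i ecoord v i ^+ 2.
have quad (s t : R) : 0 <= s ^+ 2 * a + s * t * dotprod u v *+ 2 + t ^+ 2 * b.
  have -> : s ^+ 2 * a + s * t * dotprod u v *+ 2 + t ^+ 2 * b =
            \sum_i (s * ecoord u i + t * ecoord v i) ^+ 2.
    rewrite /a /b /dotprod !mulr_sumr -sumrMnl -!big_split/=.
    by apply: eq_bigr => i _; ring.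
  by apply: sumr_ge0 => i _; exact: sqr_ge0.
have a0 : 0 <= a by exact: sumsq_ge0.
have b0 : 0 <= b by exact: sumsq_ge0.
have [b_eq0|b_neq0] := eqVneq b 0.
  have v0 i : ecoord v i = 0.
    have /eqP := b_eq0; rewrite psumr_eq0; last by move=> j _; exact: sqr_ge0.
    by move=> /allP/(_ i (mem_index_enum _))/=; rewrite sqrf_eq0 => /eqP.
  rewrite /dotprod big1 ?expr0n ?mulr_ge0// => i _; by rewrite v0 mulr0.
have bp : 0 < b by rewrite lt_neqAle eq_sym b_neq0.
rewrite -(ler_pM2l bp); have := quad b (- dotprod u v).
by lra.
Qed.

Lemma ler_enormD u v : enorm (u + v) <= enorm u + enorm v.
Proof.
rewrite -(@ler_pXn2r _ 2)// ?nnegrE ?addr_ge0 ?enorm_ge0//.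
rewrite sqrrD !sqr_enorm.
have -> : \sum_i ecoord (u + v) i ^+ 2 = \sum_i ecoord u i ^+ 2 +
    dotprod u v *+ 2 + \sum_i ecoord v i ^+ 2.
  rewrite /dotprod -sumrMnl -!big_split/=; apply: eq_bigr => i _.
  by rewrite ecoordD; ring.
by rewrite lerD2r lerD2l lerMn2r dotprod_le orbT.
Qed.

Lemma enorm_eq0 v : enorm v = 0 -> v = 0.
Proof.
move=> v0; have /eqP : \sum_i ecoord v i ^+ 2 = 0.
  by rewrite -sqr_enorm v0 expr0n.
rewrite psumr_eq0; last by move=> j _; exact: sqr_ge0.
move=> /allP H; apply: ecoord_eqP => i.
have := H i (mem_index_enum _); rewrite /= sqrf_eq0 => /eqP ->.
by rewrite [RHS]mxE.
Qed.

Lemma enormN v : enorm (- v) = enorm v.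
Proof.
by congr Num.sqrt; apply: eq_bigr => i _; rewrite ecoordN sqrrN.
Qed.

Lemma enormMn v n : enorm (v *+ n) = enorm v *+ n.
Proof.
rewrite -[RHS]mulr_natr -[n%:R]ger0_norm ?ler0n// -sqrtr_sqr /enorm.
rewrite -sqrtrM ?sumsq_ge0// mulr_suml; congr Num.sqrt.
apply: eq_bigr => i _; rewrite -exprMn; congr (_ ^+ 2).
by rewrite /ecoord [LHS]mulmxnE mulr_natr.
Qed.

HB.instance Definition _ := Num.Zmodule_isNormed.Build R (euclidean R d)
  ler_enormD enorm_eq0 enormMn enormN.

Lemma enormE v : `|v| = Num.sqrt (\sum_i ecoord v i ^+ 2).
Proof. by []. Qed.

Let edist u v : R := `|u - v|.

Let edistxx u : edist u u = 0.
Proof. by rewrite /edist subrr normr0. Qed.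

Let edist_positivity u v : edist u v = 0 -> u = v.
Proof. by move/normr0_eq0/eqP; rewrite subr_eq0 => /eqP. Qed.

Let edist_sym u v : edist u v = edist v u.
Proof. exact: distrC. Qed.

Let edist_triangle v u w : edist u w <= edist u v + edist v w.
Proof. exact: ler_distD. Qed.

HB.instance Definition _ := isMetric.Build R (euclidean R d)
  edistxx edist_positivity edist_sym edist_triangle.

Lemma edistE u v : mdist u v = `|u - v|.
Proof. by []. Qed.

End euclidean_space.

Section zeta_dimension.
Context {R : realType}.

Section metric_space.
Context {X : metricType R}.
Implicit Types (A E F : set X) (a : X) (r s : R).

(** The library's [closed_ball] is the closure of the open ball, which may be
    smaller in a general metric space. *)
Definition mclosed_ball a r : set X := [set x | mdist a x <= r].

Definition diameter A : \bar R :=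
  ereal_sup (0%E |` [set (mdist x y)%:E | x in A & y in A]).

(** Takes the value [+oo] when there is no finite cover, since
    [ereal_inf set0 = +oo]. *)
Definition covering_number E r : \bar R :=
  ereal_inf [set n%:R%:E | n in [set n : nat |
    exists U : 'I_n -> set X,
      (forall i, (diameter (U i) <= r%:E)%E) /\ E `<=` \bigcup_i U i]].

Definition growth_exponent a F r : \bar R :=
  ereal_inf [set sigma%:E | sigma in [set sigma : R | 0 <= sigma /\
    exists2 C : R, 0 < C & exists2 R0 : R, 0 < R0 &
      forall rho : R, R0 <= rho ->
        (covering_number (mclosed_ball a rho `&` F) r
           <= (C * rho `^ sigma)%:E)%E]].

Definition upper_zeta_dim a F : \bar R :=
  lim (growth_exponent a F r @[r --> +oo]).

Lemma covering_number_nonincreasing E r s : r <= s ->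
  (covering_number E s <= covering_number E r)%E.
Proof.
move=> rs; apply: ereal_inf_le_tmp => _ [n [U [dU EU]] <-].
exists n => //; exists U; split=> // i.
by rewrite (le_trans (dU i))// lee_fin.
Qed.

Lemma growth_exponent_nonincreasing a F r s : r <= s ->
  (growth_exponent a F s <= growth_exponent a F r)%E.
Proof.
move=> rs; apply: ereal_inf_le_tmp => _ [sigma [s0 [C C0 [R0 R00 H]]] <-].
exists sigma => //; split=> //; exists C => //; exists R0 => // rho Rrho.
exact: le_trans (covering_number_nonincreasing _ rs) (H _ Rrho).
Qed.

(** The limit defining [upper_zeta_dim] exists, so [lim] never takes its
    default value. *)
Lemma is_cvg_growth_exponent a F :
  cvg (growth_exponent a F r @[r --> +oo]).
Proof.
apply/cvg_ex; eexists; apply: nonincreasing_cvge => r s.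
exact: growth_exponent_nonincreasing.
Qed.

End metric_space.

Section euclidean_sets.
Context {d : nat}.
Implicit Types (A F : set (euclidean R d)) (sigma : R).

Definition uniformly_separated F : Prop :=
  (0 < ereal_inf [set e | exists x y : euclidean R d,
                    [/\ F x, F y, x != y & e = `|x - y|%:E]])%E.

Definition zeta_fun A sigma : \bar R :=
  \esum_(v in A `\ (0 : euclidean R d)%R) (`|v| `^ (- sigma))%:E.

Definition convergence_exponent F : \bar R :=
  ereal_inf [set sigma%:E | sigma in [set sigma : R | 0 <= sigma /\
    (\esum_(v in F `\ (0 : euclidean R d)%R) (`|v| `^ (- sigma))%:E < +oo)%E]].

Definition int_lattice : set (euclidean R d) :=
  [set v | forall i, ecoord v i \is a Num.int].

Definition Dim_zeta A : \bar R :=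
  ereal_inf [set sigma%:E | sigma in [set sigma : R | 0 <= sigma /\
    (zeta_fun A sigma < +oo)%E]].

End euclidean_sets.
End zeta_dimension.

(* Main.v *)
Require Import Defs.
From mathcomp Require Import all_boot all_order all_algebra finmap.
From mathcomp Require Import all_classical all_reals all_analysis.
From mathcomp Require Import lra.

Set Implicit Arguments.
Unset Strict Implicit.
Unset Printing Implicit Defensive.

Import Order.TTheory GRing.Theory Num.Theory.

Local Open Scope classical_set_scope.
Local Open Scope ring_scope.

(** For a uniformly separated set the upper zeta dimension and the convergence
    exponent both measure the polynomial growth rate of the number of points of
    [F] in a ball of radius [rho].

    On the side of the dimension: a subset of [F] of diameter at most [r] has at
    most [K] points, where [K] depends only on [r], the separation and [d]
    ([packing_bound], a pigeonhole argument on a fine grid). Hence the number of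
    points of a bounded part of [F] and its covering number at scale [r] differ
    by a factor of at most [K + 1] ([card_le_covering_number] and
    [covering_number_le_bound]), and the growth exponent at every scale [r] is
    the growth exponent of the counting function ([covering_growthE]). So the
    function of [r] whose limit defines the dimension is constant.

    On the side of the series: if the sum of [`|v| `^ (- sigma)] is finite, each
    of the points with [`|v| <= rho] contributes at least [rho `^ (- sigma)], so
    there are O([rho `^ sigma]) of them ([counting_growth_of_summable]).
    Conversely, if there are O([rho `^ sigma]) points in the ball of radius
    [rho] and [sigma < tau], then the dyadic shell between the radii
    [2 ^+ k * R0] and [2 ^+ k.+1 * R0] contributes to the series of exponent
    [tau] at most the [k]-th term of a geometric series of ratio
    [2 `^ (sigma - tau) < 1] ([summable_of_counting_growth]).
    The two infima therefore agree.

    A set of lattice points is 1-separated, as a nonzero integer coordinate of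
    [x - y] has absolute value at least 1. This gives the second claim, as
    [Dim_zeta] unfolds to [convergence_exponent].

    All cardinalities are controlled through arbitrary finite subsets, so that
    the finiteness of [F] in a ball is a consequence and not a prerequisite. *)

(** * Finite subsets and sums over arbitrary sets *)

Section finite_sums.
Context {R : realType} {T : choiceType}.
Implicit Types (S : set T) (f : T -> R) (A : {fset T}).

Lemma fset_sum_le_esum S f A : [set` A] `<=` S ->
  ((\sum_(v <- A) f v)%:E <= \esum_(v in S) (f v)%:E)%E.
Proof.
move=> AS; apply: esum_ge; exists [set` A]; first by split.
by rewrite fsbig_finite//= set_fsetK sumEFin.
Qed.

Lemma esum_le_fset S f (M : R) :
  (forall A, [set` A] `<=` S -> \sum_(v <- A) f v <= M) ->
  (\esum_(v in S) (f v)%:E <= M%:E)%E.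
Proof.
move=> SM; apply: ge_ereal_sup => _ [X [Xfin XS] <-].
rewrite fsbig_finite//= sumEFin lee_fin; apply: SM => x /=.
by rewrite in_fset_set// inE; exact: XS.
Qed.

Lemma fset_card_sum A : (#|` A|)%:R = \sum_(v <- A) 1 :> R.
Proof. by rewrite big_const_seq count_predT iter_addr_0. Qed.

Lemma finite_set_card_bound S (M : R) :
  (forall A, [set` A] `<=` S -> (#|` A|)%:R <= M) -> finite_set S.
Proof.
move=> SM; apply: contrapT => /infinite_set_fset Sinf.
have [A AS nA] := Sinf (Num.truncn M).+1.
have := le_trans _ (SM A AS); move=> /(_ (Num.truncn M).+1%:R).
by rewrite ler_nat nA leNgt truncnS_gt => /(_ isT).
Qed.

End finite_sums.

(** * Bounded parts of separated sets *)

Section packing.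
Context {R : realType} {d : nat}.
Implicit Types (A : {fset euclidean R d}) (u v : euclidean R d) (r del : R).

Lemma ecoordB u v i : ecoord (u - v) i = ecoord u i - ecoord v i.
Proof. by rewrite ecoordD ecoordN. Qed.

Lemma ecoord_le_norm v i : `|ecoord v i| <= `|v|.
Proof.
rewrite enormE -sqrtr_sqr ler_wsqrtr// (bigD1 i)//= lerDl.
by apply: sumr_ge0 => j _; exact: sqr_ge0.
Qed.

(** The constant [d] in place of [Num.sqrt d] is not sharp; it keeps the grid
    argument below rational. *)
Lemma norm_le_ecoord v (c : R) : 0 <= c ->
  (forall i, `|ecoord v i| <= c) -> `|v| <= d%:R * c.
Proof.
move=> c0 vc; rewrite enormE.
have dc0 : 0 <= d%:R * c by rewrite mulr_ge0.
rewrite -[leRHS]ger0_norm// -sqrtr_sqr ler_wsqrtr//.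
have le1 : \sum_i ecoord v i ^+ 2 <= \sum_(i < d) c ^+ 2.
  apply: ler_sum => i _; rewrite -[leLHS]real_normK ?num_real//.
  by rewrite lerXn2r ?nnegrE.
apply: (le_trans le1).
rewrite big_const_ord iter_addr_0 exprMn -[leLHS]mulr_natl ler_wpM2r ?sqr_ge0//.
by rewrite -natrX ler_nat; case: (d) => // n; rewrite leq_pmulr.
Qed.

(** Pigeonhole on a grid of mesh [1 / m] with [d / m < del]: two points in the
    same cell are at distance at most [d / m], so a cell holds at most one point
    of [A], and [A] lies in a cube of side [r + r], which meets a bounded number
    of cells. *)
Lemma packing_bound del r : 0 < del -> exists K : nat, forall A,
  {in A &, forall x y, x != y -> del <= `|x - y|} ->
  {in A &, forall x y, `|x - y| <= r} -> (#|` A| <= K)%N.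
Proof.
move=> del0.
have [m m0 mdel] : exists2 m : nat, 0 < m%:R :> R & d%:R / m%:R < del.
  exists (Num.truncn (d%:R / del)).+1 => //.
  by rewrite ltr_pdivrMr// mulrC -ltr_pdivrMr// truncnS_gt.
pose K := (Num.truncn ((r + r) * m%:R)).+1.
exists (K ^ d)%N => A sepA diamA.
have [->|[v0 v0A]] := fset_0Vmem A; first by rewrite cardfs0.
(* The cube is centred at [v0] and shifted by [r], so that cell coordinates are
   natural numbers. *)
pose g v i := (ecoord v i - ecoord v0 i + r) * m%:R.
have g0 v i : v \in A -> 0 <= g v i.
  move=> vA; rewrite mulr_ge0//.
  have := le_trans (ecoord_le_norm (v - v0) i) (diamA _ _ vA v0A).
  by rewrite ecoordB ler_norml; lra.
have gK v i : v \in A -> (Num.truncn (g v i) < K)%N.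
  move=> vA; rewrite ltnS le_truncn// ler_wpM2r//.
  have := le_trans (ecoord_le_norm (v - v0) i) (diamA _ _ vA v0A).
  by rewrite ecoordB ler_norml; lra.
pose cell (v : A) : {ffun 'I_d -> 'I_K} :=
  [ffun i => Ordinal (gK (val v) i (valP v))].
suff /leq_card : injective cell by rewrite card_ffun !card_ord cardfE.
move=> u v /ffunP uv; apply/val_inj/eqP/negPn/negP => neq.
have := sepA _ _ (valP u) (valP v) neq; apply/negP; rewrite -ltNge.
apply: le_lt_trans mdel; apply: norm_le_ecoord => // i.
have := uv i; rewrite !ffunE => /(congr1 val)/= tuv.
have /andP[u1 u2] := truncn_itv (g0 _ i (valP u)).
have /andP[v1 v2] := truncn_itv (g0 _ i (valP v)).
rewrite tuv in u1 u2.
rewrite -(ler_pM2r m0) mulVf ?gt_eqF// -{1}(gtr0_norm m0) -normrM ecoordB.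
move: u1 u2 v1 v2; rewrite -!natr1 /g ler_norml => *; apply/andP; split; lra.
Qed.

End packing.

(** * Covering numbers and counting *)

Section covering.
Context {R : realType} {X : metricType R}.
Implicit Types (E : set X) (A : {fset X}) (r : R).

(** Cover a finite set by its singletons, which have diameter 0. *)
Lemma covering_number_le_card A r : 0 <= r ->
  (covering_number [set` A] r <= (#|` A|)%:R%:E)%E.
Proof.
move=> r0; apply: ereal_inf_lbound; exists #|` A| => //.
have [->|[x0 _]] := fset_0Vmem A.
  exists (fun=> set0); split => [[i i0]|x //].
  by exfalso; move: i0; rewrite cardfs0.
exists (fun i : 'I_#|` A| => [set nth x0 A i]); split=> [i|x /= xA].
  apply: ge_ereal_sup => _ [->|[x ->] [y ->] <-]; first by rewrite lee_fin.
  by rewrite mdistxx lee_fin.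
have ix : (index x A < #|` A|)%N by rewrite index_mem.
by exists (Ordinal ix) => //=; rewrite nth_index.
Qed.

(** Each set of a cover by [n] sets of diameter at most [r] holds at most [K]
    points of [E], so [#|A| <= n * K]. Dividing by [K.+1] avoids a separate case
    [K = 0]. *)
Lemma card_le_covering_number E r (K : nat) :
  (forall A, [set` A] `<=` E -> {in A &, forall x y, mdist x y <= r} ->
     (#|` A| <= K)%N) ->
  forall A, [set` A] `<=` E ->
  (((#|` A|)%:R / K.+1%:R)%:E <= covering_number E r)%E.
Proof.
move=> packE A AE; apply: le_ereal_inf_tmp => _ [n [U [dU EU]] <-].
rewrite lee_fin ler_pdivrMr// -natrM ler_nat.
rewrite card_fset_sum1.
apply: (@leq_trans (\sum_(x <- A) \sum_(i < n) (x \in U i))).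
  rewrite !big_seq; apply: leq_sum => x /AE/EU [i _ Uix].
  by rewrite (bigD1 i)//= mem_set.
(* Double counting of the pairs of a point and a member of the cover. *)
rewrite exchange_big/=.
apply: (@leq_trans (\sum_(i < n) K)%N); last first.
  by rewrite sum_nat_const card_ord leq_mul2l leqnSn orbT.
apply: leq_sum => i _.
rewrite (eq_bigr (fun x => if x \in U i then 1%N else 0%N)); last first.
  by move=> x _; case: (_ \in _).
rewrite -big_mkcond/= big_fset_condE/= -card_fset_sum1.
apply: packE => [x /=|x y]; first by rewrite !inE => /andP[/AE].
rewrite !inE => /andP[_ /set_mem Ux] /andP[_ /set_mem Uy].
rewrite -lee_fin; apply: le_trans (dU i); apply: ereal_sup_ubound; right.
by exists x => //; exists y.
Qed.

(** A uniform bound on the cardinals of the finite subsets of [E] forces [E] to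
    be finite, so that singletons cover it. *)
Lemma covering_number_le_bound E r (M : R) : 0 <= r ->
  (forall A, [set` A] `<=` E -> (#|` A|)%:R <= M) ->
  (covering_number E r <= M%:E)%E.
Proof.
move=> r0 EM; have /finite_fsetP[A EA] := finite_set_card_bound EM.
by rewrite EA (le_trans (covering_number_le_card A r0))// lee_fin EM// EA.
Qed.

(** The condition that [mclosed_ball a rho `&` F] has O([rho `^ sigma]) points,
    phrased through finite subsets so that it makes sense before the
    intersection is known to be finite. *)
Definition counting_growth (a : X) (F : set X) (sigma : R) : Prop :=
  exists2 C : R, 0 < C & exists2 R0 : R, 0 < R0 & forall rho : R, R0 <= rho ->
    forall A, [set` A] `<=` mclosed_ball a rho `&` F ->
      (#|` A|)%:R <= C * rho `^ sigma.

(** The ball of radius [rho] around [b] is contained in the ball of radius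
    [2 * rho] around [a] once [mdist a b <= rho]; doubling the radius costs the
    factor [2 `^ sigma]. This moves the centre to the origin, where the zeta
    series lives. *)
Lemma counting_growth_center (a b : X) F sigma : 0 <= sigma ->
  counting_growth a F sigma -> counting_growth b F sigma.
Proof.
move=> s0 [C C0 [R0 R00 H]].
exists (C * 2 `^ sigma); first by rewrite mulr_gt0 ?powR_gt0.
exists (R0 + mdist a b) => [|rho rhoR]; first by rewrite ltr_wpDr ?mdist_ge0.
move=> A Ab; have ab := mdist_ge0 a b.
have -> : C * 2 `^ sigma * rho `^ sigma = C * (2 * rho) `^ sigma.
  by rewrite powRM ?mulrA//; lra.
apply: H; first by lra.
move=> x /Ab[/= bx Fx]; split => //=.
have := metric_triangle a b x; rewrite /mclosed_ball/=.
by move: bx; rewrite /mclosed_ball/=; lra.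
Qed.

(** Covering and counting have the same polynomial growth at every scale, as
    they differ by a bounded factor. *)
Lemma covering_growthE (a : X) F r sigma (K : nat) : 0 <= r ->
  (forall A, [set` A] `<=` F -> {in A &, forall x y, mdist x y <= r} ->
     (#|` A| <= K)%N) ->
  (exists2 C : R, 0 < C & exists2 R0 : R, 0 < R0 & forall rho : R, R0 <= rho ->
    (covering_number (mclosed_ball a rho `&` F) r <= (C * rho `^ sigma)%:E)%E)
  <-> counting_growth a F sigma.
Proof.
move=> r0 packF; split=> [] [C C0 [R0 R00 H]]; last first.
  exists C => //; exists R0 => // rho /H{}H.
  exact: covering_number_le_bound.
exists (C * K.+1%:R); first by rewrite mulr_gt0.
exists R0 => // rho Rrho A AF.
rewrite mulrAC -ler_pdivrMr// -lee_fin; apply: le_trans (H _ Rrho).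
apply: card_le_covering_number AF => B BF; apply: packF.
by move=> x /BF[].
Qed.

End covering.

(** * Counting functions and convergence of the zeta series *)

Section zeta_series.
Context {R : realType} {d : nat}.
Implicit Types (F : set (euclidean R d)) (A : {fset euclidean R d}).
Implicit Types (v : euclidean R d) (sigma tau rho : R).

Lemma mclosed_ball0 rho v :
  mclosed_ball (0 : euclidean R d) rho v <-> `|v| <= rho.
Proof. by rewrite /mclosed_ball/= edistE sub0r normrN. Qed.

Lemma powRN_le (x y s : R) : 0 <= s -> 0 < x -> x <= y ->
  y `^ (- s) <= x `^ (- s).
Proof.
move=> s0 x0 xy; have y0 := lt_le_trans x0 xy.
rewrite !powRN lef_pV2 ?posrE ?powR_gt0//.
by apply: ge0_ler_powR; rewrite // nnegrE ltW.
Qed.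

(** Each nonzero point of norm at most [rho] contributes at least
    [rho `^ (- sigma)] to the convergent sum [S], so there are at most
    [S * rho `^ sigma] of them. *)
Lemma counting_growth_of_summable F sigma : 0 <= sigma ->
  (\esum_(v in F `\ (0%R : euclidean R d)) (`|v| `^ (- sigma))%:E < +oo)%E ->
  counting_growth (0 : euclidean R d) F sigma.
Proof.
move=> s0.
have : (0 <= \esum_(v in F `\ (0%R : euclidean R d)) (`|v| `^ (- sigma))%:E)%E.
  by apply: esum_ge0 => v _; rewrite lee_fin powR_ge0.
case E : (\esum_(v in F `\ (0%R : euclidean R d)) _)%E => [S| |]// S0 _.
have {}S0 : 0 <= S by rewrite -lee_fin.
(* The summand 1 pays for the origin, which the series omits but the counting
   includes. *)
exists (S + 1); first by rewrite ltr_wpDl.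
exists 1 => // rho rho1 A AF.
have rs1 : 1 <= rho `^ sigma.
  rewrite [leLHS](_ : 1 = 1 `^ sigma); last by rewrite powR1.
  by rewrite ge0_ler_powR// nnegrE; lra.
have A0F : [set` (A `\ (0 : euclidean R d))%fset] `<=` F `\ (0 : euclidean R d).
  by move=> v /=; rewrite !inE => /andP[/eqP v0 /AF[_ Fv]].
have := fset_sum_le_esum (fun v => `|v| `^ (- sigma)) A0F.
rewrite E lee_fin => sumS.
have : (#|` A `\ (0%R : euclidean R d)|%fset)%:R * rho `^ (- sigma) <= S.
  apply: le_trans sumS; rewrite fset_card_sum mulr_suml !big_seq.
  apply: ler_sum => v; rewrite !inE mul1r => /andP[v0 /AF[/mclosed_ball0 vr _]].
  by rewrite powRN_le// normr_gt0.
rewrite powRN ler_pdivrMr ?powR_gt0//; last lra.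
rewrite mulrDl mul1r (cardfsD1 (0 : euclidean R d) A) natrD => H.
by rewrite addrC lerD// (le_trans _ rs1)// lern1 leq_b1.
Qed.

(** The shell [b k < `|v| <= b k.+1] has at most [C * b k.+1 `^ sigma] points,
    each contributing at most [b k `^ (- tau)], which makes [D * q ^+ k] with
    [q < 1]. The bounded core [`|v| <= R0] is a finite set and contributes a
    finite amount [M], whatever the size of its smallest nonzero element. *)
Lemma summable_of_counting_growth F sigma tau : 0 <= sigma -> sigma < tau ->
  counting_growth (0 : euclidean R d) F sigma ->
  (\esum_(v in F `\ (0%R : euclidean R d)) (`|v| `^ (- tau))%:E < +oo)%E.
Proof.
move=> s0 st [C C0 [R0 R00 H]].
pose b (k : nat) : R := 2 ^+ k * R0.
have b0 k : 0 < b k by rewrite mulr_gt0 ?exprn_gt0.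
have bR k : R0 <= b k by rewrite ler_peMl ?exprn_ege1 ?ler1n// ltW.
have bS k : b k.+1 = 2 * b k by rewrite /b exprS mulrA.
pose q : R := 2 `^ (sigma - tau).
have q0 : 0 < q by exact: powR_gt0.
have q1 : q < 1.
  rewrite /q -opprB powRN invf_lt1 ?powR_gt0//.
  rewrite [ltLHS](_ : 1 = 1 `^ (tau - sigma)); last by rewrite powR1.
  by rewrite gt0_ltr_powR ?nnegrE ?subr_gt0// ltr1n.
have bq k : b k `^ (sigma - tau) = R0 `^ (sigma - tau) * q ^+ k.
  elim: k => [|k IH]; first by rewrite /b !expr0 mul1r mulr1.
  by rewrite bS powRM// ?ltW// IH exprS mulrCA.
pose D := C * 2 `^ sigma * R0 `^ (sigma - tau).
have D0 : 0 < D by rewrite !mulr_gt0 ?powR_gt0.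
have shell k : C * b k.+1 `^ sigma * b k `^ (- tau) = D * q ^+ k.
  rewrite bS powRM ?ltW// /D -[RHS]mulrA -bq powRD ?(gt_eqF (b0 k)) ?implybT//.
  by rewrite !mulrA.
have core_fin : finite_set (F `&` [set v | `|v| <= R0]).
  apply: (@finite_set_card_bound R _ _ (C * R0 `^ sigma)) => A AF.
  by apply: (H R0) => // v /AF[Fv vR]; split => //; apply/mclosed_ball0.
have [core coreE] := (iffLR finite_fsetP core_fin).
pose M := \sum_(v <- core) `|v| `^ (- tau).
have inner A k : [set` A] `<=` F `\ (0 : euclidean R d) ->
  \sum_(v <- A | `|v| <= b k) `|v| `^ (- tau) <= M + series (geometric D q) k.
  move=> AF; elim: k => [|k IH].
    rewrite seriesEnat/= big_geq// addr0 big_fset_condE/= /M.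
    rewrite -lee_fin -[leRHS]sumEFin.
    rewrite -[in leRHS](set_fsetK core).
    rewrite -fsbig_finite//= -esum_fset//.
    apply: fset_sum_le_esum; rewrite -coreE => v /=.
    rewrite !inE => /andP[/AF[Fv _]].
    by rewrite /b expr0 mul1r.
  rewrite seriesEnat/= big_nat_recr//= addrA.
  rewrite (bigID (fun v => `|v| <= b k))/=; apply: lerD.
    rewrite (eq_bigl (fun v => `|v| <= b k)).
      by move: IH; rewrite seriesEnat.
    move=> v; apply: andb_idl => vk; rewrite (le_trans vk)// bS.
    by have := b0 k; lra.
  rewrite big_fset_condE/=; set B := [fset _ in _ | _]%fset.
  rewrite -shell; apply: (@le_trans _ _ (\sum_(v <- B) b k `^ (- tau))).
    rewrite !big_seq; apply: ler_sum => v; rewrite !inE/= => /andP[_ /andP[_]].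
    by rewrite -ltNge => /ltW; apply: powRN_le => //; lra.
  rewrite -[X in \sum_(_ <- _) X]mul1r -mulr_suml -fset_card_sum.
  rewrite ler_wpM2r ?powR_ge0// (H (b k.+1))// => v /=.
  by rewrite !inE => /andP[/AF[Fv _] /andP[vk _]]; split=> //;
    apply/mclosed_ball0.
(* A finite subset of [F] lies in some ball of radius [b k], so [inner] bounds
   its sum uniformly. *)
apply: (@le_lt_trans _ _ (M + D / (1 - q))%:E); last exact: ltry.
apply: esum_le_fset => A AF.
have [k kA] : exists k, forall v, v \in A -> `|v| <= b k.
  pose s := \sum_(v <- A) `|v|.
  exists (Num.truncn (s / R0)).+1 => v vA.
  apply: (@le_trans _ _ s).
    by rewrite /s (bigD1_seq v vA (fset_uniq A))/= lerDl sumr_ge0.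
  rewrite /b -ler_pdivrMr//; apply: ltW; apply: (lt_trans (truncnS_gt _)).
  by rewrite -natrX ltr_nat ltn_expl.
rewrite big_seq (eq_bigr (fun v => `|v| `^ (- tau)))//.
rewrite (eq_bigl (fun v => (v \in A) && (`|v| <= b k))); last first.
  by move=> v; rewrite andb_idr//; exact: kA.
rewrite -big_seq_cond; apply: (le_trans (inner A k AF)); rewrite lerD2l.
by apply: geometric_le_lim => //; rewrite ?ltW// gtr0_norm.
Qed.

End zeta_series.

(** * Comparison of the two exponents *)

Section main.
Context {R : realType} {d : nat}.
Implicit Types (F : set (euclidean R d)).

(** The infimum is [+oo] when [F] has at most one point; any positive separation
    is then valid. *)
Lemma uniformly_separatedP F : uniformly_separated F ->
  exists2 del : R, 0 < del &
    forall x y, F x -> F y -> x != y -> del <= `|x - y|.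
Proof.
rewrite /uniformly_separated; set S := (X in ereal_inf X) => S0.
have lbS x y : F x -> F y -> x != y -> (ereal_inf S <= `|x - y|%:E)%E.
  by move=> Fx Fy xy; apply: ereal_inf_lbound; exists x, y.
case: (ereal_inf S) S0 lbS => [e| |]// e0 lbS.
  by exists e => // x y Fx Fy xy; rewrite -lee_fin lbS.
by exists 1 => // x y Fx Fy xy; have := lbS x y Fx Fy xy.
Qed.

Lemma int_lattice_separated F : F `<=` int_lattice -> uniformly_separated F.
Proof.
move=> Fint; apply: (@lt_le_trans _ _ 1%:E); first by rewrite lte_fin.
apply: le_ereal_inf_tmp => _ [x [y [Fx Fy xy ->]]]; rewrite lee_fin.
have [i xyi] : exists i, ecoord x i != ecoord y i.
  apply: contrapT => /forallNP xyE; move: xy.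
  rewrite (@ecoord_eqP _ _ x y) ?eqxx// => i.
  by apply/eqP/negPn/negP.
apply: le_trans (ecoord_le_norm _ i); rewrite ecoordB norm_intr_ge1 ?subr_eq0//.
by rewrite rpredB// Fint.
Qed.

(** Holds at every scale, not only in the limit, because the separation of [F]
    makes the scale irrelevant. If [F] has O([rho `^ sigma]) points, the series
    may still diverge at [sigma] (as for the integers at 1), so one inequality
    passes through the exponents [sigma + e]. *)
Lemma growth_exponent_separated (a : euclidean R d) F r :
  uniformly_separated F -> 0 <= r ->
  growth_exponent a F r = convergence_exponent F.
Proof.
move=> /uniformly_separatedP[del del0 sepF] r0.
have [K packK] := @packing_bound R d del r del0.
have packF A : [set` A] `<=` F -> {in A &, forall x y, mdist x y <= r} ->
    (#|` A| <= K)%N.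
  move=> AF diamA; apply: packK => // x y xA yA; apply: sepF; exact: AF.
apply/eqP; rewrite eq_le; apply/andP; split.
  apply: ereal_inf_le_tmp => _ [sigma [s0 sumF] <-]; exists sigma => //.
  split=> //; apply/(covering_growthE a sigma r0 packF).
  exact/(counting_growth_center a s0)/counting_growth_of_summable.
apply: le_ereal_inf_tmp => _ [sigma [s0 growF] <-].
move/(covering_growthE a sigma r0 packF) : growF => growF.
apply/lee_addgt0Pr => e e0; apply: ereal_inf_lbound.
exists (sigma + e) => //; split; first by rewrite addr_ge0// ltW.
apply: (summable_of_counting_growth s0); first by rewrite ltrDl.
exact: counting_growth_center growF.
Qed.
End main.

Theorem theorem1p1 (R : realType) (d : nat) (a : euclidean R d) :
  (forall F : set (euclidean R d),
     uniformly_separated F -> upper_zeta_dim a F = convergence_exponent F) /\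
  (forall F : set (euclidean R d),
     F `<=` int_lattice -> upper_zeta_dim a F = Dim_zeta F).
Proof.
have sepE (F : set (euclidean R d)) :
    uniformly_separated F -> upper_zeta_dim a F = convergence_exponent F.
  move=> sepF; apply: lim_near_cst; first exact: ereal_hausdorff.
  by exists 0; split=> // r /ltW r0; exact: growth_exponent_separated.
split=> // F /int_lattice_separated; exact: sepE.
Qed.
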